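(* Let $n\ge 3$ and $k\ge 3$ be odd with $n\equiv 2\pmod{k-2}$, and put $m=\frac{n-2}{k-2}$. Let $F_k(n)$ be the number of $k$-angulations of a regular $n$-gon that are fixed by the reflection across a specific axis of symmetry of the $n$-gon. Then $$F_k(n)=R_{k-1,\frac{k-1}{2}}\left(\frac{m-1}{2}\right).$$
   Context: A $k$-angulation of an $n$-gon is a set of interior diagonals of the $n$-gon that dissects it into $k$-gons (pairwise non-crossing; empty if $n=k$). Symmetries of the $n$-gon act on $k$-angulations via their action on the vertices. The Raney numbers are $R_{p,r}(j)=\frac{r}{jp+r}\binom{jp+r}{j}$. *)

(* Defs.v *)
From mathcomp Require Import all_boot all_order all_algebra.
Set Implicit Arguments.
Unset Strict Implicit.
Unset Printing Implicit Defensive.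

(* The vertices of the regular n-gon are labelled 0, ..., n - 1 in cyclic
   order by 'I_n, and a segment between two vertices is the two-element set of
   its endpoints. *)

Section Polygon.
Variable n : nat.
Implicit Types (S d e : {set 'I_n}) (D : {set {set 'I_n}}).

(* Sides and diagonals of the convex polygon with vertex set S.  Since enum S
   is increasing, next (enum S) i is the vertex following i in the cyclic order
   of S.  The n-gon itself is the case S = [set: 'I_n]. *)
Definition sides S : {set {set 'I_n}} :=
  [set [set i; next (enum S) i] | i in S].

Definition diagonals S : {set {set 'I_n}} :=
  [set d : {set 'I_n} | (d \subset S) && (#|d| == 2)] :\: sides S.

(* Segments with a common endpoint do not cross. *)
Definition crossing d e : bool :=
  [exists a : 'I_n, exists b : 'I_n, exists a' : 'I_n, exists b' : 'I_n,
    [&& a < b, b < a', a' < b' &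
        ((d == [set a; a']) && (e == [set b; b'])) ||
        ((e == [set a; a']) && (d == [set b; b']))]].

Definition noncrossing D : bool :=
  [forall d in D, forall e in D, ~~ crossing d e].

(* The polygons into which a non-crossing set D of diagonals dissects the
   n-gon, given by their vertex sets: they are bounded by sides of the n-gon
   and members of D.  A member of D that meets the interior of such a polygon
   crosses none of its sides, hence is one of its diagonals, so the last
   condition says that D does not cut the polygon further. *)
Definition cell D S : bool :=
  [&& 3 <= #|S|,
      sides S \subset sides [set: 'I_n] :|: D &
      [disjoint D & diagonals S]].

Definition kangulation (k : nat) D : bool :=
  [&& D \subset diagonals [set: 'I_n],
      noncrossing D &
      [forall S : {set 'I_n}, cell D S ==> (#|S| == k)]].

Lemma polygon_gt0 (i : 'I_n) : 0 < n.
Proof. exact: leq_ltn_trans (leq0n i) (ltn_ord i). Qed.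

(* i |-> c - i modulo n.  With vertex j at angle 2 pi j / n, this is the
   reflection across the line through the centre at angle pi c / n; as c varies
   these are all the n axes of symmetry of the n-gon. *)
Definition reflection (c i : 'I_n) : 'I_n :=
  Ordinal (ltn_pmod (c + (n - i)) (polygon_gt0 i)).

Definition reflect_diagonals (c : 'I_n) D : {set {set 'I_n}} :=
  [set reflection c @: d | d : {set 'I_n} in D].

Definition num_fixed_kangulations (k : nat) (c : 'I_n) : nat :=
  #|[set D : {set {set 'I_n}} | kangulation k D & reflect_diagonals c D == D]|.

End Polygon.

Definition raney (p r j : nat) : rat :=
  (r%:R / (j * p + r)%:R * 'C(j * p + r, j)%:R)%R.

(* Main.v *)
Require Import Defs.
From mathcomp Require Import all_boot all_order all_algebra.
From mathcomp Require Import zify.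
Set Implicit Arguments.
Unset Strict Implicit.
Unset Printing Implicit Defensive.

(* With n odd all axes are conjugate under reflections, so one may take the
   axis through the vertex h = (n-1)/2 and the midpoint of the side
   {0, n-1}.  Read a diagonal {x, y} with x < y as an arc from x to y: a
   non-crossing set of arcs is an ordered forest, whose cells are the vertices
   below an arc that no smaller arc passes over.  The cell at the side
   {0, n-1} is invariant and has an odd number of vertices, so it contains the
   fixed vertex h.  Hence the reflection-invariant k-angulations correspond to
   forests on [0, h] with (k-1)/2 roots in which each arc has k-1 children.

   Let F(a, r) be the number of such forests with r roots on [a, b].  Either no
   arc starts at a, and one discards a, or one removes the longest arc at a,
   which promotes its k-1 children to roots:
     F(a, r+1) = F(a+1, r) + F(a, r + k-1).
   By Pascal's rule the solution is C(N, j) - (k-2) C(N, j-1) with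
   N = j(k-1) + r - 1 and b - a = r + j(k-2), which is the Raney number. *)

(** * Forests of arcs on an interval: deleting and adding the longest arc at the left end *)

Section Arcs.
Implicit Types (R : rel nat) (a b v x y : nat).

(** The bounds [x < v] and [y <= b] are carried by the ordinal types; the finite quantifiers make
    the predicate boolean for any relation on [nat]. *)
Definition covered R a b v : bool :=
  [exists x : 'I_v, exists y : 'I_b.+1, [&& a <= x, v < y & R x y]].

Lemma coveredP R a b v :
  reflect (exists x y, [/\ a <= x, x < v, v < y, y <= b & R x y])
          (covered R a b v).
Proof.
apply: (iffP existsP) => [[x /existsP[y /and3P[ax vy Rxy]]]|].
  by exists x, y; split=> //; rewrite -ltnS.
move=> [x [y [ax xv vy yb Rxy]]]; exists (Ordinal xv); apply/existsP.
by exists (Ordinal (yb : y < b.+1)); rewrite ax vy.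
Qed.

(** This is the number of vertices of the cell seen from an imaginary arc above the whole
    interval. *)
Definition exposed R a b : nat := \sum_(a <= v < b.+1) ~~ covered R a b v.

Definition del_arc R a b : rel nat :=
  fun x y => R x y && ((x != a) || (y != b)).

Definition laminar R : Prop := forall x y x' y',
  R x y -> R x' y' -> x < x' -> x' < y -> y < y' -> False.

(** Roots and children are the gaps between consecutive exposed vertices, each filled by a unit step
    or by an arc; so [r.+1] exposed vertices mean [r] roots. An arc hides everything below it, hence
    it is deleted before the vertices of its own cell are counted: [k] of them mean [k.-1]
    children. *)
Definition forest k R a b r : Prop :=
  [/\ forall x y, R x y -> [/\ a <= x, x.+1 < y & y <= b],
      laminar R,
      forall x y, R x y -> exposed (del_arc R x y) x y = k
    & exposed R a b = r.+1].

Lemma eq_covered R R' a b v :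
  (forall x y, a <= x -> y <= b -> R x y = R' x y) ->
  covered R a b v = covered R' a b v.
Proof.
by move=> eqR; apply/coveredP/coveredP=> -[x [y [ax xv vy yb Rxy]]];
  exists x, y; split=> //; move: Rxy; rewrite eqR.
Qed.

Lemma eq_exposed R R' a b :
  (forall x y, a <= x -> y <= b -> R x y = R' x y) ->
  exposed R a b = exposed R' a b.
Proof. by move=> eqR; apply: eq_bigr => v _; rewrite (eq_covered v eqR). Qed.

Lemma covered_left R a b : covered R a b a = false.
Proof. by apply/coveredP=> -[x [y [ax xa _ _ _]]]; lia. Qed.

Lemma covered_right R a b : covered R a b b = false.
Proof. by apply/coveredP=> -[x [y [_ _ ly yb _]]]; lia. Qed.

Lemma covered_arc R a b x y v : R x y -> a <= x -> y <= b -> x < v -> v < y ->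
  covered R a b v.
Proof. by move=> Rxy ax yb xv vy; apply/coveredP; exists x, y. Qed.

Lemma sum_bool_le (P : pred nat) a b : \sum_(a <= v < b) P v <= b - a.
Proof.
rewrite -[b - a]muln1 -sum_nat_const_nat; apply: leq_sum => v _.
exact: leq_b1.
Qed.

Lemma exposed_le R a b : exposed R a b <= b.+1 - a.
Proof. exact: (sum_bool_le (fun v => ~~ covered R a b v)). Qed.

Lemma exposed_ends R a b : a < b ->
  exposed R a b = (\sum_(a.+1 <= v < b) ~~ covered R a b v).+2.
Proof.
move=> ab; rewrite /exposed big_ltn; last lia.
by rewrite big_nat_recr //= covered_left covered_right addn1 add1n.
Qed.

Lemma exposed_arc R a b : a < b -> R a b -> exposed R a b = 2.
Proof.
move=> ab Rab; rewrite exposed_ends // big_nat big1 // => v /andP[av vb].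
by rewrite (covered_arc Rab).
Qed.

Lemma exposed_point R a : exposed R a a = 1.
Proof. by rewrite /exposed big_nat1 covered_left. Qed.

(** An arc over [v] that reached beyond [y] would cover [y] as well. *)
Lemma covered_prefix R a b y v :
  ~~ covered R a b y -> v <= y -> y <= b -> covered R a b v = covered R a y v.
Proof.
move=> ncy vy yb; apply/coveredP/coveredP=> -[x [z [ax xv vz zb Rxz]]].
  exists x, z; split=> //; rewrite leqNgt; apply: contra ncy => yz.
  by apply: (covered_arc Rxz) => //; lia.
by exists x, z; split=> //; lia.
Qed.

Lemma exposed_prefix R a b y :
  ~~ covered R a b y -> y <= b ->
  exposed R a y = \sum_(a <= v < y.+1) ~~ covered R a b v.
Proof.
move=> ncy yb; apply: eq_big_nat => v /andP[av vy].
by rewrite (covered_prefix ncy).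
Qed.

(** An arc over [y] starts before [x] and covers [x], or starts inside the arc from [x] to [y] and
    crosses it, or starts at [x] and is longer. *)
Lemma max_arc_uncovered R a b x y : laminar R -> R x y -> x < y ->
  ~~ covered R a b x -> (forall z, R x z -> z <= b -> z <= y) ->
  ~~ covered R a b y.
Proof.
move=> lamR Rxy xy ncx maxy; apply/coveredP=> -[u [z [au uy yz zb Ruz]]].
have [ux|xu|eux] := ltngtP u x.
- by move/negP: ncx; apply; apply: (covered_arc Ruz) => //; lia.
- exact: (lamR _ _ _ _ Rxy Ruz).
- by rewrite eux in Ruz; have := maxy _ Ruz zb; lia.
Qed.

Lemma longest_arc R x b y0 : R x y0 -> y0 <= b ->
  exists y, [/\ R x y, y <= b & forall z, R x z -> z <= b -> z <= y].
Proof.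
move=> Rxy0 y0b.
have ex : exists y, R x y && (y <= b) by exists y0; rewrite Rxy0.
have ub y : R x y && (y <= b) -> y <= b by case/andP.
case: (ex_maxnP ex ub) => y /andP[Rxy yb] maxy.
by exists y; split=> // z Rxz zb; apply: maxy; rewrite Rxz.
Qed.

(** Take for [v] the end of the longest arc at [u], or [u.+1] if no arc starts there. *)
Lemma next_exposed R a b u : laminar R -> (forall x y, R x y -> x < y) ->
  ~~ covered R a b u -> a <= u -> u < b ->
  exists v, [/\ u < v, v <= b, ~~ covered R a b v & (v == u.+1) || R u v].
Proof.
move=> lamR ltR ncu au ub.
have [|nex] := boolP [exists y : 'I_b.+1, R u y].
  case/existsP=> y0 /longest_arc-/(_ _ (ltn_ord y0 : y0 <= b)).
  move=> [y [Ruy yb maxy]]; have uy := ltR _ _ Ruy.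
  exists y; split; rewrite ?Ruy ?orbT //.
  exact: (max_arc_uncovered lamR Ruy).
exists u.+1; split; rewrite ?eqxx //.
apply/coveredP=> -[x [y [ax xu uy yb Rxy]]].
have [eux|neux] := eqVneq x u.
  case/existsP: nex; exists (Ordinal (yb : y < b.+1)) => /=.
  by rewrite -eux.
by move/negP: ncu; apply; apply: (covered_arc Rxy) => //; lia.
Qed.

Lemma covered_del_arc R a b y v : R a y -> y <= b ->
  covered R a b v = covered (del_arc R a y) a b v || (a < v < y).
Proof.
move=> Ray yb; apply/coveredP/orP.
  move=> [x [z [ax xv vz zb Rxz]]].
  have [/andP[/eqP ex /eqP ez]|ne] := boolP ((x == a) && (z == y)).
    by right; rewrite -ex xv -ez.
  left; apply/coveredP; exists x, z; split=> //.
  by rewrite /del_arc Rxz; move: ne; rewrite negb_and.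
case=> [/coveredP[x [z [ax xv vz zb /andP[Rxz _]]]]|/andP[av vy]].
  by exists x, z.
by exists a, y.
Qed.

(** Up to [y], the arc leaves only its two ends exposed; beyond [y] it covers nothing. *)
Lemma exposed_del_arc R a b y : R a y -> a < y -> y <= b ->
  ~~ covered (del_arc R a y) a b y ->
  exposed (del_arc R a y) a b + 2 =
    exposed R a b + exposed (del_arc R a y) a y.
Proof.
move=> Ray ay yb ncy.
have ncyR : ~~ covered R a b y by rewrite (covered_del_arc _ Ray) // ltnn andbF orbF.
have split (S : rel nat) : ~~ covered S a b y ->
  exposed S a b = exposed S a y + \sum_(y.+1 <= v < b.+1) ~~ covered S a b v.
  move=> nc; rewrite (exposed_prefix nc) // -big_cat_nat //; lia.
rewrite (split _ ncy) (split _ ncyR) (exposed_arc ay Ray).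
rewrite (_ : \sum_(_ <= _ < _) ~~ covered R a b _ =
             \sum_(y.+1 <= v < b.+1) ~~ covered (del_arc R a y) a b v); first lia.
apply: eq_big_nat => v /andP[yv vb]; rewrite (covered_del_arc _ Ray) //.
by rewrite [_ < y]ltnNge [y <= v]ltnW // andbF orbF.
Qed.

(* Were R a y not the longest arc at a, it could lie under R x z. *)
Lemma exposed_cell_del_arc R a y x z : a <= x ->
  (forall w, R a w -> w <= y) -> del_arc R a y x z ->
  exposed (del_arc (del_arc R a y) x z) x z = exposed (del_arc R x z) x z.
Proof.
move=> ax maxy /andP[Rxz ne]; apply: eq_exposed => u w xu wz.
rewrite /del_arc; case Ruw: (R u w) => //=.
have [eu|//] := eqVneq u a; have [ew|//] := eqVneq w y; rewrite /= ?eu ?ew.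
have ex : x = a by lia.
have := maxy z; rewrite -ex Rxz => /(_ isT) zy.
by move: ne; rewrite ex eqxx /=; lia.
Qed.

(** The deleted arc was one root and its [k.-1] children become roots. Maximality keeps [y] exposed
    and the other cells unchanged. The last two conclusions characterise [y] as the [k]-th exposed
    vertex of what remains, which makes the deletion reversible. *)
Lemma forest_del_arc k R a b r y : 1 < k -> forest k R a b r.+1 -> R a y ->
  (forall z, R a z -> z <= y) ->
  [/\ forest k (del_arc R a y) a b (r + k.-1), a <= y <= b,
      ~~ covered (del_arc R a y) a b y
    & exposed (del_arc R a y) a y = k].
Proof.
move=> k1 [inR lamR cellR cntR] Ray maxy; have [_ ay yb] := inR _ _ Ray.
have lam' : laminar (del_arc R a y).
  by move=> u v u' v' /andP[Ruv _] /andP[Ruv' _]; apply: lamR Ruv Ruv'.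
have ncyR : ~~ covered R a b y.
  apply: (max_arc_uncovered lamR Ray); rewrite ?covered_left //; first lia.
  by move=> z Raz _; apply: maxy.
have ncy : ~~ covered (del_arc R a y) a b y.
  by move: ncyR; rewrite (covered_del_arc _ Ray) // negb_or => /andP[].
split=> //; last exact: cellR.
  split=> //.
  - by move=> u v /andP[/inR].
  - move=> u v Ruv; case/andP: (Ruv) => /[dup] /inR[au _ _] /cellR <- _.
    exact: exposed_cell_del_arc.
  - have := exposed_del_arc Ray (ltnW ay) yb ncy.
    by rewrite cntR cellR //; lia.
by rewrite yb andbT; lia.
Qed.

Definition add_arc R a b : rel nat :=
  fun x y => R x y || ((x == a) && (y == b)).

(** Inverse of [forest_del_arc]. The new arc is the longest at [a]: an old one going further would
    cover [y], and one ending at [y] would leave only two exposed vertices in the prefix, fewer than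
    [k]. *)
Lemma forest_add_arc k R a b r y : 2 < k -> forest k R a b (r + k.-1) ->
  a <= y <= b -> ~~ covered R a b y -> exposed R a y = k ->
  forest k (add_arc R a y) a b r.+1 /\ (forall z, R a z -> z < y).
Proof.
move=> k2 [inR lamR cellR cntR] /andP[ay yb] ncy expy.
have ay2 : a.+1 < y by have := exposed_le R a y; lia.
have maxy z : R a z -> z < y.
  move=> Raz; have [_ az zb] := inR _ _ Raz; rewrite ltnNge; apply/negP=> yz.
  have [yz'|ezy] := boolP (y < z).
    by move/negP: ncy; apply; apply: (covered_arc Raz) => //; lia.
  have ez : z = y by lia.
  by move: Raz; rewrite ez => Ray; have := exposed_arc (ltnW ay2) Ray; lia.
have delK u v : del_arc (add_arc R a y) a y u v = R u v.
  rewrite /del_arc /add_arc -negb_and.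
  have [/andP[/eqP-> /eqP->]|] := boolP ((u == a) && (v == y)).
    by rewrite andbF; apply/esym/negP=> /maxy; rewrite ltnn.
  by rewrite orbF andbT.
have addRay : add_arc R a y a y by rewrite /add_arc !eqxx orbT.
have covE v : covered (del_arc (add_arc R a y) a y) a b v = covered R a b v.
  exact: eq_covered.
have expE c d : exposed (del_arc (add_arc R a y) a y) c d = exposed R c d.
  exact: eq_exposed.
split=> //; split.
- move=> u v /orP[/inR//|/andP[/eqP-> /eqP->]].
  by [].
- move=> u v u' v' /orP[Ruv|/andP[/eqP-> /eqP->]] /orP[Ruv'|/andP[/eqP-> /eqP->]].
  + exact: lamR Ruv Ruv'.
  + by have [] := inR _ _ Ruv; lia.
  + move=> au uy yv; have [_ _ vb] := inR _ _ Ruv'.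
    by move/negP: ncy; apply; apply: (covered_arc Ruv') => //; lia.
  + lia.
- move=> u v; rewrite /add_arc => /orP[Ruv|/andP[/eqP-> /eqP->]]; last first.
    by rewrite (expE a y) expy.
  have [au _ _] := inR _ _ Ruv.
  have max' w : add_arc R a y a w -> w <= y.
    by case/orP=> [/maxy/ltnW//|/andP[_ /eqP->]].
  rewrite -(@exposed_cell_del_arc _ a y) ?delK // -(cellR _ _ Ruv).
  apply: eq_exposed => s t _ _; rewrite /del_arc.
  by rewrite -[_ && (_ || (t != y))]/(del_arc (add_arc R a y) a y s t) delK.
- have := exposed_del_arc addRay (ltnW ay2) yb.
  by rewrite covE !expE cntR expy => /(_ ncy); lia.
Qed.

(** The count of exposed vertices up to [y] grows by at most one per step, so the first [y] at which
    it reaches [k] is itself exposed and gives exactly [k]. *)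
Lemma exposed_prefix_exists R a b k : 0 < k -> a <= b -> k <= exposed R a b ->
  exists y, [/\ a <= y <= b, ~~ covered R a b y & exposed R a y = k].
Proof.
move=> k0 ab kle.
pose P y := k <= \sum_(a <= v < y.+1) ~~ covered R a b v.
have exP : exists y, P y by exists b.
case: (ex_minnP exP) => y Py miny.
have yb : y <= b by apply: miny.
have ay : a <= y.
  by rewrite leqNgt; apply/negP=> ya; move: Py; rewrite /P big_geq //; lia.
have prev : \sum_(a <= v < y) ~~ covered R a b v < k.
  rewrite ltnNge; apply/negP; case: y ay Py miny {yb} => [|y'] ay Py miny le.
    by move: le; rewrite big_geq //; lia.
  by have := miny y' le; rewrite ltnn.
have ncy : ~~ covered R a b y.
  by move: Py; rewrite /P big_nat_recr //=; case: covered => //=; lia.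
exists y; split=> //; first by rewrite ay.
rewrite (exposed_prefix ncy yb) big_nat_recr //= ncy.
by move: Py; rewrite /P big_nat_recr //= ncy; lia.
Qed.

Lemma exposed_prefix_unique R a b y y' :
  a <= y <= b -> a <= y' <= b -> ~~ covered R a b y -> ~~ covered R a b y' ->
  exposed R a y = exposed R a y' -> y = y'.
Proof.
wlog yy : y y' / y <= y'.
  move=> H; case: (leqP y y') => [|/ltnW] yy; first exact: H.
  by move=> ? ? ? ? E; apply/esym; apply: H.
move=> /andP[ay yb] /andP[ay' yb'] nc nc'.
rewrite (exposed_prefix nc) // (exposed_prefix nc') //.
have [//|ne] := eqVneq y y'; have {ne}yy : y < y' by lia.
rewrite (@big_cat_nat _ _ _ y.+1 _ y'.+1) //=; try lia.
rewrite [X in _ = _ + X]big_nat_recr //= nc'; lia.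
Qed.

Lemma forest_no_arc k R a b r : a < b -> (forall y, R a y = false) ->
  forest k R a b r.+1 <-> forest k R a.+1 b r.
Proof.
move=> ab noR.
have cnt : exposed R a b = (exposed R a.+1 b).+1.
  rewrite /exposed big_ltn; last lia.
  rewrite covered_left /= add1n; congr _.+1; apply: eq_big_nat => v _.
  congr (nat_of_bool (~~ _)).
  apply/coveredP/coveredP=> -[x [y [ax xv vy yb Rxy]]]; exists x, y; split=> //.
    by rewrite ltn_neqAle ax andbT; apply: contraTneq Rxy => <-; rewrite noR.
  exact: ltnW.
split=> -[inR lamR cellR cntR]; split=> //; try lia.
  move=> x y Rxy; have [ax xy yb] := inR _ _ Rxy; split=> //.
  by rewrite ltn_neqAle ax andbT; apply: contraTneq Rxy => <-; rewrite noR.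
by move=> x y /inR[ax xy yb]; split=> //; exact: ltnW.
Qed.

End Arcs.

(** * Forests as sets of segments, and the recurrence for their number *)

Section Segments.
Variable n : nat.
Implicit Types (D E : {set {set 'I_n}}) (d : {set 'I_n}) (x y : nat).

(** The endpoints are natural numbers, so that [chord] is a relation on [nat] to which the results
    on arcs apply. *)
Definition seg x y : {set 'I_n} :=
  [set i : 'I_n | (i == x :> nat) || (i == y :> nat)].

Definition chord D : rel nat := fun x y => [&& x < y, y < n & seg x y \in D].

Definition segments D : bool := [forall d in D, #|d| == 2].

Lemma segE (i j : 'I_n) : seg i j = [set i; j].
Proof. by apply/setP=> u; rewrite !inE !val_eqE. Qed.

Lemma segC x y : seg x y = seg y x.
Proof. by apply/setP=> u; rewrite !inE orbC. Qed.

Lemma seg_inj x y x' y' : x < y -> y < n -> x' < y' -> y' < n ->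
  seg x y = seg x' y' -> x = x' /\ y = y'.
Proof.
move=> xy yn xy' yn' /setP E.
have xn : x < n by lia. have xn' : x' < n by lia.
have := E (Ordinal xn); have := E (Ordinal yn).
have := E (Ordinal xn'); have := E (Ordinal yn').
by rewrite !inE /=; lia.
Qed.

Lemma card_seg x y : x < y -> y < n -> #|seg x y| = 2.
Proof.
move=> xy yn; have xn : x < n by lia.
by rewrite (segE (Ordinal xn) (Ordinal yn)) cards2 -val_eqE /= neq_ltn xy.
Qed.

Lemma card2_seg d : #|d| = 2 -> exists x y, [/\ x < y, y < n & d = seg x y].
Proof.
move=> /eqP/cards2P[i [j [ne ->]]].
case: (ltngtP i j) => [ij|ji|/val_inj e]; last by rewrite e eqxx in ne.
  by exists i, j; rewrite segE.
by exists j, i; rewrite segC segE.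
Qed.

Lemma segments_seg D d : segments D -> d \in D ->
  exists x y, [/\ x < y, y < n & d = seg x y].
Proof. by move=> /forall_inP h /h/eqP/card2_seg. Qed.

Lemma chord_inj D E : segments D -> segments E -> chord D =2 chord E -> D = E.
Proof.
have sub (D1 D2 : {set {set 'I_n}}) :
    segments D1 -> chord D1 =2 chord D2 -> {subset D1 <= D2}.
  move=> s1 eqA d dD; have [x [y [xy yn ed]]] := segments_seg s1 dD.
  by have := eqA x y; rewrite /chord -ed dD xy yn.
move=> sD sE eqA; apply/setP=> d; apply/idP/idP.
  exact: sub sD eqA d.
by apply: sub sE _ d => x y; rewrite eqA.
Qed.

Lemma chord_setD1 D a y : a < y -> y < n ->
  chord (D :\ seg a y) =2 del_arc (chord D) a y.
Proof.
move=> ay yn u v; rewrite /chord /del_arc in_setD1.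
case: ltnP => //= uv; case: ltnP => //= vn; rewrite andbC; congr (_ && _).
have [[-> ->]|ne] := eqVneq (u, v) (a, y); first by rewrite !eqxx.
transitivity true.
  apply: contra ne => /eqP/seg_inj[] // -> ->.
  by [].
by apply/esym; rewrite -negb_and; apply: contra ne => /andP[/eqP-> /eqP->].
Qed.

Lemma chord_setU1 D a y : a < y -> y < n ->
  chord (seg a y |: D) =2 add_arc (chord D) a y.
Proof.
move=> ay yn u v; rewrite /chord /add_arc in_setU1.
have [/andP[/eqP-> /eqP->]|ne] := boolP ((u == a) && (v == y)).
  by rewrite ay yn eqxx orbT.
rewrite orbF; case: ltnP => //= uv; case: ltnP => //= vn.
suff /negPf-> : seg u v != seg a y by [].
by apply: contra ne => /eqP/seg_inj[] // -> ->; rewrite !eqxx.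
Qed.

(** Boolean form of [forest], needed to count. Quantifying over ['I_n] is enough because [chord]
    bounds its endpoints by [n]. *)
Definition forest_set k a b r D : bool :=
  [&& segments D,
      [forall x : 'I_n, forall y : 'I_n, chord D x y ==>
         [&& a <= x, x.+1 < y, y <= b &
             exposed (del_arc (chord D) x y) x y == k]],
      [forall x : 'I_n, forall y : 'I_n, forall x' : 'I_n, forall y' : 'I_n,
         ~~ [&& chord D x y, chord D x' y', x < x', x' < y & y < y']]
    & exposed (chord D) a b == r.+1].

Lemma chord_lt D x y : chord D x y -> (x < y) * (y < n) * (x < n).
Proof. by case/and3P=> xy yn _; rewrite xy yn (ltn_trans xy yn). Qed.

Lemma forest_setP k a b r D :
  reflect (segments D /\ forest k (chord D) a b r) (forest_set k a b r D).
Proof.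
apply: (iffP and4P) => [[sD /'forall_'forall_implyP inR lam /eqP cnt]|].
  have cell x y : chord D x y -> [&& a <= x, x.+1 < y, y <= b &
             exposed (del_arc (chord D) x y) x y == k].
    move=> Dxy; have := chord_lt Dxy => -[[xy yn] xn].
    exact: (inR (Ordinal xn) (Ordinal yn)).
  split=> //; split=> //; try by move=> x y /cell/and4P[].
    move=> x y x' y' Dxy Dxy' xx' xy' yy'.
    have [[xy yn] xn] := chord_lt Dxy; have [[_ yn'] xn'] := chord_lt Dxy'.
    move: lam => /forallP/(_ (Ordinal xn))/forallP/(_ (Ordinal yn)).
    move=> /forallP/(_ (Ordinal xn'))/forallP/(_ (Ordinal yn')) /=.
    by rewrite Dxy Dxy' xx' xy' yy'.
  by move=> x y /cell/and4P[_ _ _ /eqP].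
move=> [sD [inR lam cell cnt]]; split=> //; last by rewrite cnt.
  apply/'forall_'forall_implyP=> x y Dxy; rewrite cell // eqxx.
  by have [-> -> ->] := inR _ _ Dxy.
apply/forallP=> x; apply/forallP=> y; apply/forallP=> x'; apply/forallP=> y'.
by apply/negP=> /and5P[Dxy Dxy' ? ? ?]; apply: lam Dxy Dxy' _ _ _.
Qed.

Lemma eq_forest k (R S : rel nat) a b r : R =2 S ->
  forest k R a b r -> forest k S a b r.
Proof.
move=> RS [inR lam cell cnt]; split.
- by move=> x y; rewrite -RS => /inR.
- by move=> x y x' y'; rewrite -!RS; apply: lam.
- move=> x y Sxy; rewrite -(cell x y) ?RS //.
  by apply: eq_exposed => u v _ _; rewrite /del_arc RS.
- by rewrite -cnt; apply: eq_exposed => u v _ _; rewrite RS.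
Qed.

Definition num_forests k a b r : nat := #|[set D | forest_set k a b r D]|.

(** The two terms count the forests without and with an arc at [a]. *)
Lemma num_forests_rec k a b r : 2 < k -> a < b -> b < n ->
  num_forests k a b r.+1 = num_forests k a.+1 b r + num_forests k a b (r + k.-1).
Proof.
move=> k2 ab bn; rewrite /num_forests.
pose noarc D := [forall y : 'I_n, ~~ chord D a y].
have noarcP D : reflect (forall y, chord D a y = false) (noarc D).
  apply: (iffP forallP) => [h y|h y]; last by rewrite h.
  apply/negP=> Day; have [[_ yn] _] := chord_lt Day.
  by have := h (Ordinal yn); rewrite Day.
rewrite -(cardsID [set D | noarc D] [set D | forest_set k a b r.+1 D]).
congr (_ + _).
  apply: eq_card => D; rewrite !inE; apply/andP/idP.
    move=> [/forest_setP[sD fD] /noarcP nD]; apply/forest_setP; split=> //.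
    exact/(forest_no_arc k r ab nD).
  move=> /forest_setP[sD fD].
  have nD : forall y, chord D a y = false.
    by case: fD => inR _ _ _ y; apply/negP=> /inR[]; lia.
  split; last exact/noarcP.
  by apply/forest_setP; split=> //; apply/(forest_no_arc k r ab nD).
(* The far end of the longest arc at [a], meaningful only when there is such an arc. *)
pose top D := \max_(y < n | chord D a y) y.
have topP D : ~~ noarc D -> chord D a (top D) /\ forall z, chord D a z -> z <= top D.
  rewrite negb_forall => /existsP[y0]; rewrite negbK => Day0; split.
    by rewrite /top (bigmax_eq_arg y0) //; case: arg_maxnP.
  move=> z Daz; have [[_ zn] _] := chord_lt Daz.
  exact: (@leq_bigmax_cond _ (fun y : 'I_n => chord D a y) _ (Ordinal zn)).
pose cut D := D :\ seg a (top D).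
have cutP D : D \in [set D | forest_set k a b r.+1 D] :\: [set D | noarc D] ->
    [/\ chord D a (top D), forest_set k a b (r + k.-1) (cut D), a <= top D <= b,
        ~~ covered (chord (cut D)) a b (top D)
      & exposed (chord (cut D)) a (top D) = k].
  rewrite !inE => /andP[nD /forest_setP[sD fD]].
  have [Dat maxt] := topP _ nD; have [[at_ tn] _] := chord_lt Dat.
  have eqc := chord_setD1 D at_ tn.
  have [|f' tb nc ex] := forest_del_arc _ fD Dat maxt; first by lia.
  split=> //.
  - apply/forest_setP; split; last by apply: eq_forest f' => u v; rewrite eqc.
    by apply/forall_inP=> d; rewrite in_setD1 => /andP[_]; apply: (forall_inP sD).
  - by rewrite (@eq_covered _ (del_arc (chord D) a (top D))) // => ? ? _ _; rewrite eqc.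
  - by rewrite -ex; apply: eq_exposed => ? ? _ _; rewrite eqc.
(* It remains to see that [cut] maps the forests with an arc at [a] bijectively onto those with
   [r + k.-1] roots. *)
rewrite -(card_in_imset (f := cut)).
  apply: eq_card => E; rewrite inE; apply/imsetP/idP.
    by case=> D /cutP[_ fD _ _ _] ->.
  move=> /forest_setP[sE fE]; have [inE_ _ _ cntE] := fE.
  (* The arc to restore ends at the [k]-th exposed vertex, which exists since [E] exposes [r + k]
     vertices. *)
  have [|||y [/andP[ay yb] nc ex]] := @exposed_prefix_exists (chord E) a b k; try lia.
  have [|fD lty] := forest_add_arc k2 fE _ nc ex; first by rewrite ay.
  have ay' : a < y by have := exposed_le (chord E) a y; lia.
  have yn : y < n by lia.
  have eqa := chord_setU1 E ay' yn.
  have Day : chord (seg a y |: E) a y by rewrite eqa /add_arc !eqxx orbT.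
  have nD : ~~ noarc (seg a y |: E).
    by apply/negP=> /noarcP/(_ y); rewrite Day.
  have ety : top (seg a y |: E) = y.
    have [Dat maxt] := topP _ nD; apply/eqP; rewrite eqn_leq maxt // andbT.
    by move: Dat; rewrite eqa => /orP[/lty/ltnW//|/andP[_ /eqP{1}->]].
  exists (seg a y |: E).
    rewrite !inE nD; apply/forest_setP; split.
      apply/forall_inP=> d; rewrite in_setU1 => /orP[/eqP->|].
        by rewrite card_seg.
      exact: (forall_inP sE).
    by apply: eq_forest fD => u v; rewrite eqa.
  rewrite /cut ety setU1K //; apply/negP=> sE_.
  have : chord E a y by rewrite /chord ay' yn.
  by move/lty; rewrite ltnn.
(* Injectivity: [top D] is recovered from [cut D] as its [k]-th exposed vertex. *)
move=> D1 D2 /cutP[D1a _ t1 nc1 e1] /cutP[D2a _ t2 nc2 e2] eqc.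
have et : top D1 = top D2.
  by apply: (exposed_prefix_unique t1 t2 nc1); rewrite ?eqc ?e2 // -eqc.
rewrite -(setD1K (proj2 (andP (proj2 (andP D1a))))).
rewrite -(setD1K (proj2 (andP (proj2 (andP D2a))))).
by rewrite -/(cut D1) -/(cut D2) eqc et.
Qed.

End Segments.

(** * Solution of the recurrence by binomials and Raney numbers *)

Lemma num_forests_point n k b : num_forests n k b b 0 = 1.
Proof.
rewrite /num_forests -(cards1 (set0 : {set {set 'I_n}})); apply: eq_card => D.
rewrite !inE; apply/forest_setP/eqP => [[sD [inR _ _ _]]|->].
  apply/eqP; rewrite -subset0; apply/subsetP=> d dD.
  have [x [y [xy yn ed]]] := segments_seg sD dD.
  suff: chord D x y by case/inR; lia.
  by rewrite /chord -ed dD xy yn.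
have chord0 x y : chord (set0 : {set {set 'I_n}}) x y = false.
  by rewrite /chord inE !andbF.
split; first by apply/forall_inP=> d; rewrite inE.
by split=> [x y|x y ? ?|x y|]; rewrite ?chord0 // exposed_point.
Qed.

Lemma num_forests_eq0 n k a b r :
  (forall R, exposed R a b <> r.+1) -> num_forests n k a b r = 0.
Proof.
move=> h; apply/eqP; rewrite cards_eq0 -subset0; apply/subsetP=> D.
by rewrite inE => /forest_setP[_ [_ _ _ /h]].
Qed.

(** Here [q] is k - 2. The subtracted binomial is moved to the left to avoid truncated subtraction,
    and the [if] stands for the convention C(N, -1) = 0. The induction is on [j], then on [r]. *)
Lemma num_forests_binomial n q b j r a : 0 < q -> a <= b -> b < n ->
  b - a = r + j * q ->
  num_forests n q.+2 a b r +
    (if j is i.+1 then q * 'C((j * q.+1 + r).-1, i) else 0) =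
  'C((j * q.+1 + r).-1, j).
Proof.
move=> q0 ab bn; elim: j r a ab => [|j IHj] r a ab.
  (* For [j = 0] there is one forest: deleting an arc at [a] would leave more exposed vertices than
     the interval has. *)
  rewrite bin0 addn0 mul0n addn0 => E.
  elim: r a ab E => [|r IHr] a ab E.
    have -> : a = b by lia.
    exact: num_forests_point.
  rewrite num_forests_rec //=; last lia.
  rewrite IHr; [|lia..]; rewrite num_forests_eq0 // => R.
  by have := exposed_le R a b; lia.
elim: r a ab => [|r IHr] a ab E.
  (* Without roots there is no forest on a proper interval, and the two binomials agree: (j+1) C(N,
     j+1) = (N-j) C(N, j) with N - j = (j+1) q. *)
  have ab' : a < b by rewrite -subn_gt0 E add0n muln_gt0.
  rewrite num_forests_eq0 => [|R]; last by rewrite exposed_ends.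
  have := mul_bin_left (j.+1 * q.+1 + 0).-1 j.
  rewrite (_ : _ - j = j.+1 * q); last by nia.
  by move=> /eqP; rewrite -mulnA eqn_pmul2l // => /eqP<-.
have ab' : a < b by rewrite -subn_gt0 E.
have -> : (j.+1 * q.+1 + r.+1).-1 = (j.+1 * q.+1 + r).-1.+1 by lia.
rewrite num_forests_rec // binS -[q.+2.-1]/q.+1.
have := IHr a.+1 ab'; rewrite subnS E => /(_ erefl).
(* Promoting the children trades one unit of [j] for [q] further roots; both terms of the recurrence
   then have the same upper index [M], and Pascal's rule adds them. *)
have := IHj (r + q.+1) a ab.
have -> : (j * q.+1 + (r + q.+1)).-1 = (j.+1 * q.+1 + r).-1 by lia.
move=> /(_ ltac:(nia)); move: (_.-1) => M.
by case: (j) => [|i]; rewrite ?bin0 ?binS; lia.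
Qed.

Lemma num_forests_raney n q b j r a : 0 < q -> a <= b -> b < n -> 0 < r ->
  b - a = r + j * q ->
  ((num_forests n q.+2 a b r)%:R = raney q.+1 r j)%R.
Proof.
move=> q0 ab bn r0 E; rewrite /raney.
have := num_forests_binomial q0 ab bn E.
have T0 : ((j * q.+1 + r)%:R != 0 :> rat)%R.
  by rewrite Num.Theory.pnatr_eq0; lia.
move: (num_forests _ _ _ _ _) => F HF.
suff H : F * (j * q.+1 + r) = r * 'C(j * q.+1 + r, j).
  apply: (GRing.mulIf T0); rewrite -GRing.natrM H.
  by rewrite GRing.mulrAC GRing.mulfVK // -GRing.natrM.
case: j E T0 HF => [|i] E _.
  by rewrite !bin0 addn0 => ->; rewrite mul0n mul1n muln1.
have := mul_bin_diag (i.+1 * q.+1 + r) i.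
have -> : 'C(i.+1 * q.+1 + r, i.+1) =
    'C((i.+1 * q.+1 + r).-1, i.+1) + 'C((i.+1 * q.+1 + r).-1, i).
  by rewrite -binS; congr 'C(_, _); lia.
(* With T = (i+1)(q+1) + r, the hypotheses are F + qA = B and TA = (i+1)(A+B); hence FT = T(A+B) -
   (q+1)TA = r(A+B). *)
move: ('C(_.-1, i)) => A; move: ('C(_.-1, i.+1)) => B.
nia.
Qed.

(** * Symmetric forests and their left halves *)

Section Mirror.
Implicit Types (R S : rel nat) (a b v x y N h : nat).

(** The endpoints are exchanged to keep arcs increasing; the guard excludes values that truncated
    subtraction would send to 0. *)
Definition mirror N R : rel nat := fun x y => (y <= N) && R (N - y) (N - x).

Lemma covered_mirror N R a b v : b <= N -> a <= v <= b ->
  covered (mirror N R) a b v = covered R (N - b) (N - a) (N - v).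
Proof.
move=> bN /andP[av vb].
apply/coveredP/coveredP=> -[x [y [ax xv vy yb Rxy]]].
  by exists (N - y), (N - x); case/andP: Rxy => _ ->; split=> //; lia.
exists (N - y), (N - x); rewrite /mirror !subKn; try lia.
by rewrite leq_subr Rxy; split=> //; lia.
Qed.

Lemma exposed_mirror N R a b : a <= b -> b <= N ->
  exposed (mirror N R) a b = exposed R (N - b) (N - a).
Proof.
move=> ab bN; rewrite /exposed -[X in index_iota X]add0n big_addn.
rewrite -[X in _ = \sum_(X <= _ < _) _]add0n big_addn big_nat_rev /=.
rewrite (_ : (N - a).+1 - (N - b) = b.+1 - a); last lia.
apply: eq_big_nat => v /andP[_ vb]; rewrite covered_mirror //; try lia.
by congr (nat_of_bool (~~ covered _ _ _ _)); lia.
Qed.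

(** The length is odd and both halves contain the centre, hence the extra [u h]. *)
Lemma sum_palindrome (u : nat -> nat) h : (forall v, v <= h -> u (h.*2 - v) = u v) ->
  \sum_(0 <= v < h.*2.+1) u v + u h = 2 * \sum_(0 <= v < h.+1) u v.
Proof.
move=> symu; rewrite (@big_cat_nat _ _ _ h _ h.*2.+1) /=; try lia.
have -> : \sum_(h <= v < h.*2.+1) u v = \sum_(0 <= v < h.+1) u v.
  rewrite -[X in \sum_(X <= _ < _) _ = _]add0n big_addn.
  rewrite (_ : h.*2.+1 - h = h.+1); last lia.
  rewrite big_nat_rev /=; apply: eq_big_nat => v /andP[_ vh].
  by rewrite -[RHS]symu; [congr u; lia | lia].
by rewrite big_nat_recr //=; lia.
Qed.

Lemma exposed_symmetric R h : R =2 mirror h.*2 R ->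
  exposed R 0 h.*2 + ~~ covered R 0 h.*2 h =
    2 * \sum_(0 <= v < h.+1) ~~ covered R 0 h.*2 v.
Proof.
move=> symR; apply: (@sum_palindrome (fun v => ~~ covered R 0 h.*2 v)) => v vh.
rewrite -[in RHS](@eq_covered (mirror h.*2 R)) => [|x y _ _]; last by rewrite -symR.
by rewrite covered_mirror ?subnn ?subn0 //; lia.
Qed.

(* A symmetric set of odd size contains the fixed point of the symmetry, so
   the odd cell at the base has a vertex on the axis and no arc crosses it. *)
Lemma symmetric_forest_split k R h : odd k -> R =2 mirror h.*2 R ->
  forest k R 0 h.*2 k.-1 -> forall x y, R x y -> (y <= h) || (h <= x).
Proof.
move=> oddk symR [inR _ _ cnt] x y Rxy.
have := exposed_symmetric symR; rewrite cnt.
have [|nch _] := boolP (covered R 0 h.*2 h); first by case: (k) oddk; lia.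
rewrite leqNgt [h <= x]leqNgt -negb_and; apply: contra nch => /andP[hy xh].
by apply: (covered_arc Rxy) => //; have [] := inR _ _ Rxy.
Qed.

Definition half h R : rel nat := fun x y => R x y && (y <= h).

(** As [h] is exposed, the [k] exposed vertices give (k+1)/2 = [k./2.+1] of them on [0, h], that is
    [k./2] roots. *)
Lemma half_forest k R h : odd k -> R =2 mirror h.*2 R ->
  forest k R 0 h.*2 k.-1 -> forest k (half h R) 0 h k./2.
Proof.
move=> oddk symR fR; have split := symmetric_forest_split oddk symR fR.
have [inR lamR cellR cnt] := fR; have := exposed_symmetric symR; rewrite cnt.
have nch : ~~ covered R 0 h.*2 h.
  by apply/coveredP=> -[x [y [_ xh hy _ /split]]]; lia.
rewrite nch -(exposed_prefix nch); last lia.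
move=> cnt2; split.
- by move=> x y /andP[/inR[]].
- by move=> x y x' y' /andP[Rxy _] /andP[Rxy' _]; apply: lamR Rxy Rxy'.
- move=> x y /andP[Rxy yh]; rewrite -(cellR _ _ Rxy); apply: eq_exposed => u v _ vy.
  by rewrite /del_arc /half (leq_trans vy yh) andbT.
- rewrite (@eq_exposed (half h R) R); first by case: (k) oddk cnt2; lia.
  by move=> u v _ vh; rewrite /half vh andbT.
Qed.

Definition double h S : rel nat := fun x y => S x y || mirror h.*2 S x y.

Lemma double_mirror h S : (forall x y, S x y -> x < y <= h) ->
  double h S =2 mirror h.*2 (double h S).
Proof.
move=> inS x y; rewrite /double /mirror orbC.
have [yh|yh] := leqP y h.*2; last first.
  by rewrite /=; apply/negP=> /inS; lia.
have [xy|yx] := leqP x y.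
  by rewrite !subKn ?leq_subr //; lia.
rewrite /= leq_subr /=; apply/idP/idP.
  by case/orP=> /inS; lia.
by case/orP=> /inS; lia.
Qed.

(** No arc passes over [h], so arcs on different sides do not interact, and the right side inherits
    the properties of the left one by reflection. The halves share the exposed vertex [h], which
    leaves 2([k./2] + 1) - 1 = k exposed vertices. *)
Lemma double_forest k S h : odd k -> forest k S 0 h k./2 ->
  forest k (double h S) 0 h.*2 k.-1.
Proof.
move=> oddk [inS lamS cellS cntS].
have dP x y : double h S x y -> (y <= h /\ S x y) \/
   [/\ h <= x, x <= y, y <= h.*2 & S (h.*2 - y) (h.*2 - x)].
  case/orP=> [Sxy|/andP[yh Sxy]]; first by left; have [] := inS _ _ Sxy.
  by right; have [_ ? ?] := inS _ _ Sxy; split=> //; lia.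
have symD : double h S =2 mirror h.*2 (double h S).
  by apply: double_mirror => x y /inS[_ ? ->]; rewrite andbT; lia.
have low x y : y <= h -> double h S x y = S x y.
  move=> yh; apply/idP/idP=> [/dP[[]//|[hx _ _ /inS[]]]|]; first by lia.
  by move=> Sxy; rewrite /double Sxy.
split.
- move=> x y /dP[[_ /inS[_ xy yh]]|[hx _ yh /inS[_ xy yx]]]; split=> //; lia.
- move=> x y x' y' /dP[[yh Sxy]|[hx xy yh Sxy]] /dP[[yh' Sxy']|[hx' xy' yh' Sxy']].
  + exact: lamS Sxy Sxy'.
  + lia.
  + have [] := inS _ _ Sxy'; lia.
  + by move=> ? ? ?; apply: (lamS _ _ _ _ Sxy' Sxy); lia.
- have lowcell x y : y <= h -> S x y -> exposed (del_arc (double h S) x y) x y = k.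
    move=> yh Sxy; rewrite -(cellS _ _ Sxy); apply: eq_exposed => u v _ vy.
    by rewrite /del_arc low //; lia.
  move=> x y /dP[[yh Sxy]|[hx xy yh Sxy]]; first exact: lowcell.
  rewrite -(lowcell _ _ _ Sxy); last lia.
  rewrite -exposed_mirror //; apply: eq_exposed => u v xu vy.
  rewrite /del_arc /mirror symD /mirror (leq_trans vy yh) /=.
  (* Being ends of an arc keeps [u] and [v] at most [h.*2], where subtraction from [h.*2] is
     injective. *)
  case Duv: (double h S (h.*2 - v) (h.*2 - u)) => //=.
  by case: (dP _ _ Duv) => [[_ /inS[]]|[_ _ _ /inS[]]]; lia.
- have nch : ~~ covered (double h S) 0 h.*2 h.
    by apply/coveredP=> -[x [y [_ xh hy _ /dP]]]; case=> -[]; lia.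
  have := exposed_symmetric symD; rewrite nch -(exposed_prefix nch); last lia.
  rewrite (@eq_exposed (double h S) S 0 h) => [|u v _ vh]; last exact: low.
  by rewrite cntS; case: (k) oddk; lia.
Qed.

Lemma half_double h S : (forall x y, S x y -> x < y <= h) ->
  half h (double h S) =2 S.
Proof.
move=> inS x y; rewrite /half /double /mirror; apply/idP/idP.
  by case/andP=> /orP[//|/andP[yh /inS]]; lia.
by move=> Sxy; rewrite Sxy; have /andP[] := inS _ _ Sxy.
Qed.

Lemma double_half h R : R =2 mirror h.*2 R ->
  (forall x y, R x y -> (y <= h) || (h <= x)) ->
  (forall x y, R x y -> x <= y <= h.*2) -> double h (half h R) =2 R.
Proof.
move=> symR split inR x y; rewrite /double /half; apply/idP/idP.
  case/orP=> [/andP[]//|/andP[yh /andP[Rxy _]]].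
  by rewrite symR /mirror yh.
move=> Rxy; case/orP: (split _ _ Rxy) => [-> |hx]; first by rewrite Rxy.
apply/orP; right; have := Rxy; rewrite symR /mirror => /andP[-> ->].
by have := inR _ _ Rxy; lia.
Qed.

End Mirror.

(** * The reflection that reverses the labels, acting on sets of segments *)

Section Reflections.
Variable n : nat.
Implicit Types (D E : {set {set 'I_n}}) (d : {set 'I_n}) (c i : 'I_n).

Lemma reflectionE c i :
  reflection c i = (if i <= c then c - i else c + n - i) :> nat.
Proof.
have := ltn_ord c; have := ltn_ord i; rewrite /reflection /= => ltin ltcn.
case: leqP => [ic|ci].
  by rewrite (_ : c + (n - i) = c - i + n) ?modnDr ?modn_small //; lia.
by rewrite modn_small //; lia.
Qed.

Lemma reflectionK c : involutive (reflection c).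
Proof.
move=> i; apply: ord_inj; rewrite !reflectionE.
have := ltn_ord i; have := ltn_ord c => ltcn ltin.
by case: (leqP i c) => ?; case: leqP; lia.
Qed.

Lemma imset_reflectionK c d : reflection c @: (reflection c @: d) = d.
Proof.
rewrite -imset_comp -[RHS]imset_id; apply: eq_imset => i /=.
exact: reflectionK.
Qed.

Lemma mem_reflect c D d :
  (d \in reflect_diagonals c D) = (reflection c @: d \in D).
Proof.
apply/imsetP/idP=> [[e eD ->]|dD]; first by rewrite imset_reflectionK.
by exists (reflection c @: d); rewrite ?imset_reflectionK.
Qed.

Lemma card_reflection c d : #|reflection c @: d| = #|d|.
Proof. exact/card_imset/(inv_inj (reflectionK c)). Qed.

Lemma segments_reflect c D : segments D -> segments (reflect_diagonals c D).
Proof.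
move=> sD; apply/forall_inP=> d; rewrite mem_reflect => dD.
by rewrite -(card_reflection c); apply: (forall_inP sD).
Qed.

(** For [c = n.-1] the reflection never wraps around; this is why that axis is the convenient one
    for arcs. *)
Lemma reflection_seg c x y : c = n.-1 :> nat -> x < n -> y < n ->
  reflection c @: seg n x y = seg n (n.-1 - y) (n.-1 - x).
Proof.
move=> cn xn yn; rewrite (segE (Ordinal xn) (Ordinal yn)) imsetU1 imset_set1.
rewrite -segE segC !reflectionE /= cn !ifT; try lia.
by [].
Qed.

Lemma chord_reflect c D : c = n.-1 :> nat ->
  chord (reflect_diagonals c D) =2 mirror n.-1 (chord D).
Proof.
move=> cn x y; rewrite /chord /mirror mem_reflect; have := ltn_ord c => cltn.
have [yn|yn] := ltnP y n; last by rewrite andbF; apply/esym/negbTE; lia.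
have [xy|xy] := ltnP x y; last first.
  by apply/esym/negbTE; rewrite !negb_and; lia.
rewrite reflection_seg //; last exact: ltn_trans xy yn.
have -> : y <= n.-1 by lia.
have -> : n.-1 - y < n.-1 - x by lia.
by have -> : n.-1 - x < n by lia.
Qed.

Lemma reflect_fixedP c D : c = n.-1 :> nat -> segments D ->
  reflect (chord D =2 mirror n.-1 (chord D)) (reflect_diagonals c D == D).
Proof.
move=> cn sD; apply: (iffP eqP) => [{1}<- x y|symD]; first exact: chord_reflect.
apply: chord_inj => //; first exact: segments_reflect.
by move=> x y; rewrite chord_reflect // -symD.
Qed.

(** The bijection is [cut], the counterpart of [half] on sets; its inverse adds the reflected
    segments, as [double] does. *)
Lemma num_symmetric_forests k h c : odd k -> n = h.*2.+1 -> c = n.-1 :> nat ->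
  #|[set D | forest_set k 0 n.-1 k.-1 D & reflect_diagonals c D == D]| =
  num_forests n k 0 h k./2.
Proof.
move=> oddk nh cn; have n1 : n.-1 = h.*2 by lia.
pose lower : {set 'I_n} := [set i : 'I_n | i <= h].
pose cut D := [set d in D | d \subset lower].
have chord_cut D : chord (cut D) =2 half h (chord D).
  move=> x y; rewrite /half /chord inE.
  case: ltnP => //= xy; case: ltnP => //= yn; congr (_ && _).
  have xn := ltn_trans xy yn.
  rewrite (segE (Ordinal xn) (Ordinal yn)) subUset !sub1set !inE /=.
  by apply/andP/idP => [[]//|yh]; split=> //; lia.
have seg_cut D : segments D -> segments (cut D).
  by move=> sD; apply/forall_inP=> d; rewrite inE => /andP[dD _]; apply: (forall_inP sD).
rewrite /num_forests -(card_in_imset (f := cut)).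
  apply: eq_card => E; rewrite [RHS]inE; apply/imsetP/idP.
    case=> D; rewrite inE => /andP[/forest_setP[sD fD]].
    move=> /(reflect_fixedP cn sD); rewrite n1 in fD * => symD ->.
    apply/forest_setP; split; first exact: seg_cut.
    by apply: eq_forest (half_forest oddk symD fD) => x y; rewrite chord_cut.
  move=> /forest_setP[sE fE].
  have inE' x y : chord E x y -> x < y <= h.
    by case: fE => inE' _ _ _ /inE'[_ xy ->]; rewrite andbT; exact: ltnW.
  pose D := E :|: reflect_diagonals c E.
  have sD : segments D.
    apply/forall_inP=> d; rewrite in_setU => /orP[]; first exact: (forall_inP sE).
    exact: (forall_inP (segments_reflect c sE)).
  have chD : chord D =2 double h (chord E).
    move=> x y; rewrite /double -n1 -(chord_reflect E cn) /D /chord in_setU.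
    by case: (_ < _) => //; case: (_ < _).
  have fD := double_forest oddk fE.
  exists D.
    rewrite inE; apply/andP; split.
      apply/forest_setP; split=> //; rewrite n1.
      by apply: eq_forest fD => x y; rewrite chD.
    apply/(reflect_fixedP cn sD) => x y; rewrite chD n1 /mirror chD.
    by apply: double_mirror => u v /inE'; lia.
  apply: chord_inj => //; first exact: seg_cut.
  move=> x y; rewrite chord_cut /half chD.
  by rewrite -[LHS](half_double inE').
have key D : D \in [set D | forest_set k 0 n.-1 k.-1 D & reflect_diagonals c D == D] ->
    segments D /\ chord D =2 double h (chord (cut D)).
  rewrite inE => /andP[/forest_setP[sD fD] /(reflect_fixedP cn sD)].
  rewrite n1 in fD * => symD; split=> // x y.
  rewrite -[LHS](double_half symD (symmetric_forest_split oddk symD fD)).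
    by rewrite /double /mirror !chord_cut.
  by case: fD => inD _ _ _ u v /inD[]; lia.
move=> D1 D2 /key[s1 c1] /key[s2 c2] e12.
by apply: chord_inj => // x y; rewrite c1 c2 e12.
Qed.

End Reflections.

(** * Sides and cells of a dissection, read as arcs *)

Section Cells.
Variable n : nat.
Implicit Types (D : {set {set 'I_n}}) (d e S : {set 'I_n}) (i j s t : 'I_n).

(** Either [j] is the successor of [i] in [S], or the cyclic order wraps around from the largest
    element to the smallest. *)
Lemma next_enumP S i : i \in S ->
  let j := next (enum S) i in j \in S /\
  ((i < j /\ forall s, s \in S -> ~~ (i < s < j)) \/
   (forall s, s \in S -> j <= s <= i)).
Proof.
move=> iS j; have jS : j \in S by rewrite -mem_enum mem_next mem_enum.
split=> //; pose r (s t : 'I_n) := s < t.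
have srt : sorted r (enum S).
  rewrite /enum_mem -enumT; apply: sorted_filter => [s t u|]; first exact: ltn_trans.
  rewrite -[sorted r _]/(sorted (relpre val ltn) _) -sorted_map val_enum_ord.
  exact: iota_ltn_sorted.
have nth_lt : {in [pred u | u < size (enum S)] &,
    {homo nth i (enum S) : u v / u < v >-> u < v}}.
  by apply: (sorted_ltn_nth _ _ srt) => s t u; exact: ltn_trans.
have idx s : s \in S -> index s (enum S) < size (enum S) /\
    nth i (enum S) (index s (enum S)) = s.
  by rewrite -mem_enum => sS; rewrite index_mem nth_index.
have idx_lt s t : s \in S -> t \in S -> (s < t) = (index s (enum S) < index t (enum S)).
  move=> /idx[ls es] /idx[lt et].
  case: (ltngtP (index s (enum S)) (index t (enum S))) => [st|ts|e].
  - by have := nth_lt _ _ ls lt st; rewrite es et.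
  - by have := nth_lt _ _ lt ls ts; rewrite es et; lia.
  - by rewrite -es -et e ltnn.
have idx_le s t : s \in S -> t \in S -> (s <= t) = (index s (enum S) <= index t (enum S)).
  by move=> sS tS; rewrite leqNgt idx_lt // -leqNgt.
have [li ei] := idx _ iS; have [lj ej] := idx _ jS.
have : index j (enum S) = (if (index i (enum S)).+1 < size (enum S)
                           then (index i (enum S)).+1 else 0).
  rewrite {1}/j next_nth mem_enum iS.
  case E: (enum S) => [|y p]; first by rewrite E in li.
  have uq : uniq (y :: p) by rewrite -E enum_uniq.
  rewrite E in li; case: ltnP => h.
    by rewrite -[nth y p _]/(nth y (y :: p) (index i (y :: p)).+1) index_uniq.
  (* Past the last element, [next] returns the default of [nth], which is the head of the list. *)
  by rewrite nth_default ?index_head.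
case: ifP => h e; [left|right].
  split=> [|s sS]; first by rewrite idx_lt // e.
  by rewrite !idx_lt // e; lia.
move=> s sS; rewrite !idx_le // e /=; have [ls _] := idx _ sS.
by rewrite -ltnS; apply: leq_trans ls _; rewrite leqNgt h.
Qed.

Lemma mem_sides S i j : i < j ->
  reflect [/\ i \in S, j \in S &
            (forall s, s \in S -> ~~ (i < s < j)) \/
            (forall s, s \in S -> i <= s <= j)]
          ([set i; j] \in sides S).
Proof.
move=> ij; have neq u v : [set i; j] = [set u; v] -> (i = u /\ j = v) \/ (i = v /\ j = u).
  move=> /setP E; have := E i; have := E j; have := E u; have := E v.
  rewrite !inE !eqxx /= ?orbT -!val_eqE /= => ? ? ? ?.
  have : (i = u :> nat /\ j = v :> nat) \/ (i = v :> nat /\ j = u :> nat) by lia.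
  by case=> -[/ord_inj-> /ord_inj->]; [left|right].
apply: (iffP imsetP) => [[u uS /neq]|[iS jS]].
  have [] := next_enumP uS; move: (next _ _) => v vS.
  move=> btw [[eu ev]|[ev eu]]; subst u v; split=> //.
    by case: btw => [[_ btw]|/(_ j vS)]; [left | lia].
  case: btw => [[]|btw]; first by lia.
  by right.
case=> btw; [exists i => // | exists j => //].
  have [] := next_enumP iS; move: (next _ _) => v vS [[iv bv]|/(_ j jS)]; last by lia.
  have := bv j jS; have := btw v vS => ? ?.
  by congr [set _; _]; apply: ord_inj; lia.
have [] := next_enumP jS; move: (next _ _) => v vS [[jv _]|bv].
  by have := btw v vS; lia.
have := bv i iS; have := btw v vS => ? ?.
by rewrite setUC; congr [set _; _]; apply: ord_inj; lia.
Qed.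

Lemma sides_pair S d : 2 <= #|S| -> d \in sides S ->
  exists i j, i < j /\ d = [set i; j].
Proof.
move=> S2 /imsetP[i iS ->]; have [] := next_enumP iS.
move: (next _ _) => j jS [[ij _]|btw]; first by exists i, j.
have := btw _ iS; rewrite leqnn andbT leq_eqVlt => /orP[/eqP/ord_inj eji|ji].
  subst j; move: S2; rewrite (_ : S = [set i]) ?cards1 //.
  apply/setP=> s; rewrite inE; apply/idP/eqP=> [/btw|->//].
  by rewrite -eqn_leq => /eqP/ord_inj.
by exists j, i; rewrite setUC.
Qed.

Lemma mem_sidesT i j : i < j ->
  ([set i; j] \in sides [set: 'I_n]) =
  (j == i.+1 :> nat) || ((i == 0 :> nat) && (j == n.-1 :> nat)).
Proof.
move=> ij; have := ltn_ord j => jn; apply/(mem_sides _ ij)/idP.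
  case=> _ _ [btw|btw].
    have i1n : i.+1 < n by lia.
    by have := btw (Ordinal i1n) (in_setT _); rewrite /=; lia.
  have n0 : 0 < n by lia. have n1 : n.-1 < n by lia.
  have := btw (Ordinal n0) (in_setT _); have := btw (Ordinal n1) (in_setT _).
  by rewrite /=; lia.
move=> h; split; rewrite ?in_setT //.
case/orP: h => [h|h]; [left|right] => s _; first lia.
by have := ltn_ord s; lia.
Qed.

Lemma chordE D i j : i < j -> chord D i j = ([set i; j] \in D).
Proof. by move=> ij; rewrite /chord ij ltn_ord segE. Qed.

Lemma noncrossingP D : segments D ->
  reflect (laminar (chord D)) (noncrossing D).
Proof.
move=> sD; apply: (iffP forall_inP) => [h x y x' y' Rxy Rxy' xx xy yy|lam d dD].
  have [[_ yn] xn] := chord_lt Rxy; have [[_ yn'] xn'] := chord_lt Rxy'.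
  have := h (seg n x y); case/and3P: (Rxy) => _ _ -> /(_ isT)/forall_inP.
  move=> /(_ (seg n x' y')); case/and3P: (Rxy') => _ _ -> /(_ isT)/negP; apply.
  apply/existsP; exists (Ordinal xn); apply/existsP; exists (Ordinal xn').
  apply/existsP; exists (Ordinal yn); apply/existsP; exists (Ordinal yn').
  by rewrite -!segE /= xx xy yy !eqxx.
apply/forall_inP=> e eD; apply/negP=> /existsP[a /existsP[b]].
move=> /existsP[a' /existsP[b' /and4P[ab ba ab']]].
have aa' : a < a' by lia. have bb' : b < b' by lia.
by case/orP=> /andP[/eqP ed /eqP ee]; apply: (lam a a' b b') => //;
  rewrite chordE // -?ed -?ee.
Qed.

(** The elements of [S] nearest to [x] on either side. *)
Lemma set_gap S x (u v : 'I_n) : u \in S -> v \in S -> u < x -> x < v ->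
  (forall s, s \in S -> s != x :> nat) ->
  exists s t, [/\ s \in S, t \in S, u <= s < x, x < t <= v
                & forall w, w \in S -> ~~ (s < w < t)].
Proof.
move=> uS vS ux xv xS.
have [|s /andP[sS sx] smax] := @arg_maxnP _ u (fun w => (w \in S) && (w < x)) val.
  by rewrite uS.
have [|t /andP[tS xt] tmin] := @arg_minnP _ v (fun w => (w \in S) && (x < w)) val.
  by rewrite vS.
exists s, t; split=> //.
- by rewrite sx andbT; apply: smax; rewrite uS.
- by rewrite xt; apply: tmin; rewrite vS.
move=> w wS; have := smax w; have := tmin w; have := xS w wS; rewrite wS /=.
case: (ltngtP w x) => //= wx _; last by move=> /(_ isT); lia.
by move=> _ /(_ isT); lia.
Qed.

Definition cell_of D a b : {set 'I_n} :=
  [set v : 'I_n | (a <= v <= b) && ~~ covered (del_arc (chord D) a b) a b v].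

Lemma card_cell_of D a b : a <= b -> b < n ->
  #|cell_of D a b| = exposed (del_arc (chord D) a b) a b.
Proof.
move=> ab bn; rewrite -sum1_card big_mkcond /=.
pose F v : nat := (a <= v <= b) && ~~ covered (del_arc (chord D) a b) a b v.
transitivity (\sum_(i < n) F i).
  by apply: eq_bigr => i _; rewrite inE /F; case: ifP.
rewrite -(big_mkord xpredT F) (@big_cat_nat _ _ _ a 0 n) /=; try lia.
rewrite (@big_cat_nat _ _ _ b.+1 a n) /=; try lia.
have -> : \sum_(0 <= v < a) F v = 0.
  by rewrite big_nat big1 // => v /andP[_ va]; rewrite /F leqNgt va.
have -> : \sum_(b.+1 <= v < n) F v = 0.
  by rewrite big_nat big1 // => v /andP[bv _]; rewrite /F [v <= b]leqNgt bv andbF.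
rewrite add0n addn0.
by apply: eq_big_nat => v /andP[av vb]; rewrite /F av -ltnS vb.
Qed.

(** The side {0, n-1} acts as an arc above everything, so that every cell lies directly below one
    such pair. *)
Definition base D a b : bool := chord D a b || ((a == 0) && (b == n.-1)).

Lemma cell_cell_of D a b : segments D -> laminar (chord D) ->
  base D a b -> a.+1 < b -> b < n -> cell D (cell_of D a b).
Proof.
move=> sD lam Dab ab bn; have an : a < n by lia.
set Q := del_arc (chord D) a b; set S := cell_of D a b.
have lamQ : laminar Q.
  by move=> x y x' y' /andP[Rxy _] /andP[Rxy' _]; apply: lam Rxy Rxy'.
have ltQ x y : Q x y -> x < y by case/andP=> /chord_lt[[]].
have memS (v : 'I_n) : (v \in S) = (a <= v <= b) && ~~ covered Q a b v by rewrite inE.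
have aS : Ordinal an \in S by rewrite memS covered_left leqnn /=; lia.
have bS : Ordinal bn \in S by rewrite memS covered_right leqnn /=; lia.
have card3 : 3 <= #|S|.
  rewrite card_cell_of //; last lia.
  (* A third vertex: since the arc from [a] to [b] is deleted, the step from [a] stops short of
     [b]. *)
  have [|||v [av vb ncv Qav]] := @next_exposed Q a b a lamQ ltQ.
  - by rewrite covered_left.
  - exact: leqnn.
  - exact: ltnW.
  have vltb : v < b.
    rewrite ltn_neqAle vb andbT; apply: contraTneq Qav => ->.
    by rewrite /Q /del_arc !eqxx andbF orbF; lia.
  rewrite exposed_ends; last exact: ltnW.
  rewrite (@big_cat_nat _ _ _ v) //=.
  by rewrite (@big_ltn _ _ _ v b) // ncv; lia.
(* Consecutive exposed vertices are joined by a unit side or by an arc. *)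
have sidesS i j : i \in S -> j \in S -> i < j ->
    (forall s, s \in S -> ~~ (i < s < j)) -> (j == i.+1 :> nat) || Q i j.
  rewrite !memS => /andP[/andP[ai ib] nci] /andP[/andP[aj jb] ncj] ij btw.
  have [|v [iv vb ncv Qiv]] := next_exposed lamQ ltQ nci ai; first lia.
  have vn : v < n by lia.
  have := btw (Ordinal vn); rewrite memS ncv /= => /(_ ltac:(lia)) nb.
  suff -> : j = v :> nat by [].
  case/orP: Qiv => [/eqP|] Qiv; first lia.
  apply/eqP; rewrite eqn_leq; apply/andP; split; first lia.
  rewrite leqNgt; apply: contra ncj => jv.
  exact: (covered_arc Qiv).
apply/and3P; split=> //.
  apply/subsetP=> d dS; have [|i [j [ij ed]]] := sides_pair _ dS; first exact: ltnW.
  move: dS; rewrite ed => /(mem_sides _ ij)[iS jS [btw|btw]].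
    rewrite in_setU mem_sidesT // -chordE //.
    by case/orP: (sidesS _ _ iS jS ij btw) => [->//|/andP[-> _]]; rewrite orbT.
  have := btw _ aS; have := btw _ bS; rewrite /= => h1 h2.
  move: iS jS; rewrite !memS => /andP[h3 _] /andP[h4 _].
  have ei : i = a :> nat by lia. have ej : j = b :> nat by lia.
  rewrite in_setU mem_sidesT // -chordE // ei ej.
  by case/orP: Dab => [->|->]; rewrite ?orbT.
(* A member of [D] with both ends in [S] is the arc from [a] to [b] or hides all vertices between
   its ends; either way it is a side of [S]. *)
apply/pred0P=> d /=; apply/negP=> /andP[dD].
rewrite !inE => /andP[/negP dside /andP[dS _]]; apply: dside.
have [x [y [xy yn ed]]] := segments_seg sD dD.
have xn := ltn_trans xy yn.
have ed' : d = [set Ordinal xn; Ordinal yn] by rewrite -segE.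
move: dS; rewrite {1}ed' subUset !sub1set => /andP[xS yS].
rewrite ed'; apply/mem_sides; rewrite //; split=> //.
have Rxy : chord D x y by rewrite /chord xy yn -ed.
move: (xS) (yS); rewrite !memS /= => /andP[/andP[ax xb] _] /andP[/andP[ay yb] _].
have [/andP[/eqP ex /eqP ey]|ne] := boolP ((x == a) && (y == b)).
  by right=> s; rewrite memS /= ex ey => /andP[].
left=> s; rewrite memS /= => /andP[_]; apply: contra => /andP[xs sy].
have Qxy : Q x y by rewrite /Q /del_arc Rxy -negb_and ne.
exact: (covered_arc Qxy).
Qed.

(** The extreme vertices [a] and [b] of [S] form its closing side, which gives [base]. The rest
    compares membership in [S] with being exposed, using the side of [S] that jumps over a missing
    vertex. *)
Lemma cell_is_cell_of D S : segments D -> laminar (chord D) -> cell D S ->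
  exists a b, [/\ base D a b, a.+1 < b, b < n & S = cell_of D a b].
Proof.
move=> sD lam /and3P[S3 /subsetP sidesS disj].
have [i0 i0S] : exists i0, i0 \in S by apply/card_gt0P; apply: leq_trans S3.
have [//|a aS mina] := @arg_minnP _ i0 (mem S) val.
have [//|b bS maxb] := @arg_maxnP _ i0 (mem S) val.
have [c cS] : exists c, c \in S :\ a :\ b.
  apply/card_gt0P; move: S3; rewrite (cardsD1 a) (cardsD1 b (S :\ a)).
  by case: (a \in S); case: (b \in _); case: #|_|.
move: cS; rewrite !inE -!val_eqE /= => /and3P[cb ca cS].
have ac := mina _ cS; have bc := maxb _ cS; rewrite /= in ac bc.
have ab : a.+1 < b by lia.
have side i j : i.+1 < j -> [set i; j] \in sides S ->
    ((i == 0 :> nat) && (j == n.-1 :> nat)) || chord D i j.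
  move=> ij /sidesS; rewrite in_setU mem_sidesT -?chordE; try exact: ltnW.
  by rewrite [j == _ :> nat]gtn_eqF.
have gap x (u v : 'I_n) : u \in S -> v \in S -> u < x -> x < v ->
    (forall s, s \in S -> s != x :> nat) ->
    exists s t, [/\ u <= s, s < x, x < t, t <= v &
      [/\ s \in S, t \in S, forall w, w \in S -> ~~ (s < w < t)
        & ((s == 0 :> nat) && (t == n.-1 :> nat)) || chord D s t]].
  move=> uS vS ux xv /(set_gap uS vS ux xv).
  move=> [s [t [sS tS /andP[us sx] /andP[xt tv] st]]].
  exists s, t; split=> //; split=> //; apply: side; first exact: leq_ltn_trans xt.
  by apply/mem_sides; [exact: ltn_trans xt | split=> //; left].
have baseab : base D a b.
  have : [set a; b] \in sides S.
    apply/mem_sides; first exact: ltnW.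
    by split=> //; right=> s sS; apply/andP; split; [exact: mina | exact: maxb].
  by rewrite /base orbC => /side->.
exists a, b; split=> //; apply/setP=> v; rewrite inE.
apply/idP/andP=> [vS|[/andP[av vb] ncv]].
  have av := mina _ vS; have vb := maxb _ vS; rewrite /= in av vb.
  split; first by rewrite av.
  apply/coveredP=> -[x [y [ax xv vy yb /andP[Rxy ne]]]].
  have [[xy yn] xn] := chord_lt Rxy.
  (* If an end of an arc over [v] were missing from [S], the side of [S] jumping over that end would
     cross the arc. *)
  have xS : Ordinal xn \in S.
    apply/negPn/negP=> nxS; have [|||] := gap x a v aS vS => //.
    - rewrite ltn_neqAle ax andbT; apply: contraNneq nxS => ex.
      by rewrite (_ : Ordinal xn = a) //; apply: ord_inj.
    - move=> s sS; apply: contraNneq nxS => ex.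
      by rewrite (_ : Ordinal xn = s) //; apply: ord_inj.
    move=> s [t [_ sx xt tv [_ _ _ st]]]; have ty := leq_ltn_trans tv vy.
    case/orP: st => [/andP[_ /eqP et]|Rst]; first by clear -et ty yn; lia.
    exact: (lam _ _ _ _ Rst Rxy).
  have yS : Ordinal yn \in S.
    apply/negPn/negP=> nyS; have [|||] := gap y v b vS bS => //.
    - rewrite ltn_neqAle yb andbT; apply: contraNneq nyS => ey.
      by rewrite (_ : Ordinal yn = b) //; apply: ord_inj.
    - move=> s sS; apply: contraNneq nyS => ey.
      by rewrite (_ : Ordinal yn = s) //; apply: ord_inj.
    move=> s [t [vs sy yt _ [_ _ _ st]]]; have xs := leq_trans xv vs.
    case/orP: st => [/andP[/eqP es _]|Rst]; first by rewrite es in xs.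
    exact: (lam _ _ _ _ Rxy Rst).
  (* With both ends in [S], the arc must be a side since no member of [D] is a diagonal of [S]; but
     [v] lies strictly between its ends. *)
  have xyS : [set Ordinal xn; Ordinal yn] \in sides S.
    have := pred0P disj [set Ordinal xn; Ordinal yn]; rewrite /= -chordE // Rxy /=.
    rewrite !inE cards2 subUset !sub1set xS yS -val_eqE /= neq_ltn xy /= andbT.
    by move/negbFE.
  case/(@mem_sides S (Ordinal xn) (Ordinal yn) xy): xyS => _ _ [/(_ v vS)|btw].
    by rewrite /= xv vy.
  have := btw _ aS; have := btw _ bS; rewrite /=; clear -ne ax yb ab; lia.
apply/negPn/negP=> nvS.
have [|||] := gap v a b aS bS => //.
- by rewrite ltn_neqAle av andbT val_eqE; apply: contraNneq nvS => <-.
- by rewrite ltn_neqAle vb andbT val_eqE; apply: contraNneq nvS => ->.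
- by move=> s sS; rewrite val_eqE; apply: contraNneq nvS => <-.
move=> s [t [as_ sv vt tb [sS tS nst st]]].
(* The third vertex [c] shows that the side over [v] is not the one from [a] to [b], so it is an arc
   that covers [v]. *)
have ncst : ~~ ((s <= a) && (b <= t)).
  by apply/negP=> /andP[sa bt]; have := nst _ cS; clear -sa bt ca cb ac bc; lia.
move/negP: ncv; apply.
have Rst : chord D s t.
  case/orP: st => // st; have := ltn_ord b; clear -st ncst; lia.
have Qst : del_arc (chord D) a b s t.
  by rewrite /del_arc Rst /=; clear -ncst; lia.
exact: (covered_arc Qst).
Qed.

(** The cells correspond to the arcs and the base side; the base cell has [k] vertices, hence [k.-1]
    roots. *)
Lemma kangulation_forest k D : 2 < n -> 2 < k ->
  kangulation k D = forest_set k 0 n.-1 k.-1 D.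
Proof.
move=> n2 k2; apply/and3P/forest_setP.
  move=> [/subsetP diagD ncD /forallP cellD].
  have sD : segments D.
    by apply/forall_inP=> d /diagD; rewrite !inE => /and3P[].
  have lam := elimT (noncrossingP sD) ncD.
  have inD x y : chord D x y -> x.+1 < y /\ ~~ ((x == 0) && (y == n.-1)).
    move=> Dxy; have [[xy yn] xn] := chord_lt Dxy; case/and3P: Dxy => _ _ /diagD.
    rewrite (segE (Ordinal xn) (Ordinal yn)) in_setD mem_sidesT //= => /andP[].
    lia.
  have cardk a b : base D a b -> a.+1 < b -> b < n ->
      exposed (del_arc (chord D) a b) a b = k.
    move=> Dab ab bn; rewrite -card_cell_of //; last lia.
    by apply/eqP/(implyP (cellD _)); apply: cell_cell_of.
  split=> //; split=> //.
  - move=> x y Dxy; have [[xy yn] xn] := chord_lt Dxy.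
    by have [] := inD _ _ Dxy; split=> //; lia.
  - move=> x y Dxy; have [[xy yn] xn] := chord_lt Dxy; have [xy1 _] := inD _ _ Dxy.
    by apply: cardk => //; rewrite /base Dxy.
  - rewrite prednK; last lia.
    rewrite -(cardk 0 n.-1); [|by rewrite /base !eqxx orbT|lia|lia].
    apply: eq_exposed => x y _ _; rewrite /del_arc.
    by case Dxy: (chord D x y) => //=; have [_] := inD _ _ Dxy; lia.
move=> [sD [inD lam cellD cnt]]; split.
- apply/subsetP=> d dD; have [x [y [xy yn ed]]] := segments_seg sD dD.
  have xn := ltn_trans xy yn.
  have Dxy : chord D x y by rewrite /chord xy yn -ed.
  rewrite !inE subsetT (forall_inP sD) // andbT ed.
  rewrite (segE (Ordinal xn) (Ordinal yn)) mem_sidesT //= negb_or.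
  have [_ xy1 _] := inD _ _ Dxy; rewrite (_ : _ != _) /=; last lia.
  (* An arc from 0 to [n.-1] would leave only two exposed vertices instead of [k]. *)
  rewrite andbT; apply/andP=> -[/eqP x0 /eqP yn1]; subst x y.
  by have := exposed_arc _ Dxy; rewrite cnt; lia.
- exact/noncrossingP.
apply/forallP=> S; apply/implyP=> /(cell_is_cell_of sD lam)[a [b [Dab ab bn ->]]].
rewrite card_cell_of //; last lia.
apply/eqP; case/orP: Dab => [/cellD//|/andP[/eqP ea /eqP eb]]; subst a b.
have {1}-> : k = exposed (chord D) 0 n.-1 by rewrite cnt; lia.
apply: eq_exposed => x y _ _; rewrite /del_arc.
case Dxy: (chord D x y) => //=; apply/idP; rewrite -negb_and; apply/negP.
move=> /andP[/eqP ex /eqP ey]; subst x y.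
by have := exposed_arc _ Dxy; rewrite cnt; lia.
Qed.

End Cells.

(** * Reflections preserve k-angulations, and all axes are conjugate for odd n *)

Section Invariance.
Variable n : nat.
Implicit Types (D : {set {set 'I_n}}) (d e S : {set 'I_n}) (i j s t c : 'I_n).

Lemma crossingC d e : crossing d e = crossing e d.
Proof. by do 4![apply: eq_existsb => ?]; rewrite orbC. Qed.

Lemma crossingI (a b a' b' : 'I_n) : a < b -> b < a' -> a' < b' ->
  crossing [set a; a'] [set b; b'].
Proof.
move=> ab ba' ab'; apply/existsP; exists a; apply/existsP; exists b.
apply/existsP; exists a'; apply/existsP; exists b'.
by rewrite ab ba' ab' !eqxx.
Qed.

(** The reflection preserves the blocks [0, c] and [c+1, n-1] and reverses each ([rev]), while
    keeping the first before the second ([jump]). The five cases are the positions of [c] among the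
    four endpoints. *)
Lemma crossing_reflection c d e :
  crossing d e -> crossing (reflection c @: d) (reflection c @: e).
Proof.
wlog: d e / exists a b a' b' : 'I_n,
    [/\ a < b, b < a', a' < b', d = [set a; a'] & e = [set b; b']].
  move=> H; case/existsP=> a /existsP[b /existsP[a' /existsP[b']]].
  case/and4P=> ab ba' ab' /orP[] /andP[/eqP -> /eqP ->].
    by apply: H; [exists a, b, a', b' | exact: crossingI].
  by rewrite crossingC; apply: H; [exists a, b, a', b' | exact: crossingI].
case=> a [b [a' [b' [ab ba' ab' -> -> _]]]]; rewrite !imsetU1 !imset_set1.
have cn := ltn_ord c; have b'n := ltn_ord b'.
have rev (u v : 'I_n) : u < v -> (v <= c) || (c < u) -> v < n ->
    reflection c v < reflection c u.
  by rewrite !reflectionE => ? ? ?; case: (leqP v c); case: (leqP u c); lia.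
have jump (u v : 'I_n) : u <= c -> c < v -> v < n -> reflection c u < reflection c v.
  by rewrite !reflectionE => ? ? ?; case: (leqP v c); case: (leqP u c); lia.
have [b'c|cb'] := leqP b' c.
  rewrite crossingC (setUC [set reflection c b]) (setUC [set reflection c a]).
  by apply: crossingI; apply: rev; lia.
have [a'c|ca'] := leqP a' c.
  rewrite (setUC [set reflection c a]).
  by apply: crossingI; [apply: rev | apply: rev | apply: jump]; lia.
have [bc|cb] := leqP b c.
  rewrite crossingC.
  by apply: crossingI; [apply: rev | apply: jump | apply: rev]; lia.
have [ac|ca] := leqP a c.
  rewrite (setUC [set reflection c b]).
  by apply: crossingI; [apply: jump | apply: rev | apply: rev]; lia.
rewrite crossingC (setUC [set reflection c b]) (setUC [set reflection c a]).
by apply: crossingI; apply: rev; lia.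
Qed.

Lemma crossing_reflectionE c d e :
  crossing (reflection c @: d) (reflection c @: e) = crossing d e.
Proof.
apply/idP/idP; last exact: crossing_reflection.
by move/(crossing_reflection c); rewrite !imset_reflectionK.
Qed.

(* Unlike the one by next (enum S), this description of the sides is visibly
   invariant under reflections. *)
Lemma sidesE S d : 2 <= #|S| -> (d \in sides S) =
  [&& d \subset S, #|d| == 2
    & [forall e : {set 'I_n}, (e \subset S) ==> ~~ crossing e d]].
Proof.
move=> S2; apply/idP/and3P=> [dS|[dS /eqP/card2_seg[x [y [xy yn ed]]] ncr]].
  have [i [j [ij ed]]] := sides_pair S2 dS.
  move: dS; rewrite ed => /(mem_sides _ ij)[iS jS btw]; split.
  - by rewrite subUset !sub1set iS.
  - by rewrite cards2 -val_eqE neq_ltn ij.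
  apply/forallP=> e; apply/implyP=> /subsetP eS; apply/negP.
  case/existsP=> a /existsP[b /existsP[a' /existsP[b' /and4P[ab ba' ab']]]].
  have inj (u v : 'I_n) : u < v -> [set i; j] = [set u; v] ->
      i = u :> nat /\ j = v :> nat.
    rewrite -!segE => uv /seg_inj E.
    by apply: E.
  have aa' : a < a' by lia. have bb' : b < b' by lia.
  case/orP=> /andP[/eqP ee /eqP ee']; move: eS.
    have [Ei Ej] := inj _ _ bb' ee'; rewrite ee => eS.
    have h1 := eS a (set21 _ _); have h2 := eS a' (set22 _ _).
    by case: btw => btw; [have := btw _ h2 | have := btw _ h1]; lia.
  have [Ei Ej] := inj _ _ aa' ee; rewrite ee' => eS.
  have h1 := eS b (set21 _ _); have h2 := eS b' (set22 _ _).
  by case: btw => btw; [have := btw _ h1 | have := btw _ h2]; lia.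
have xn := ltn_trans xy yn; set i := Ordinal xn; set j := Ordinal yn.
have {}ed : d = [set i; j] by rewrite -segE.
have ij : i < j by []; move: dS; rewrite ed subUset !sub1set => /andP[iS jS].
apply/(mem_sides _ ij); split=> //.
have [/exists_inP[s sS /andP[si sj]]|nbtw] := boolP [exists s in S, i < s < j].
  right=> t tS; apply/negPn/negP; rewrite negb_and -!ltnNge => tout.
  have /negP[] : ~~ crossing [set s; t] d.
    by apply: (implyP (forallP ncr _)); rewrite subUset !sub1set sS.
  rewrite ed; case/orP: tout => [ti|jt].
    by rewrite setUC; apply: crossingI.
  by rewrite crossingC; apply: crossingI.
left=> s sS; apply: contra nbtw => h; apply/exists_inP; by exists s.
Qed.

Lemma subset_reflection c d S :
  (reflection c @: d \subset S) = (d \subset reflection c @: S).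
Proof.
by apply/idP/idP=> /(imsetS (reflection c)); rewrite imset_reflectionK.
Qed.

Lemma sides_reflection c S d : 2 <= #|S| ->
  (d \in sides (reflection c @: S)) = (reflection c @: d \in sides S).
Proof.
move=> S2; rewrite !sidesE ?card_reflection // subset_reflection.
congr [&& _, _ & _]; apply/forallP/forallP=> h e.
  by have := h (reflection c @: e); rewrite subset_reflection imset_reflectionK
    -{1}[d](imset_reflectionK c) crossing_reflectionE.
by have := h (reflection c @: e); rewrite subset_reflection crossing_reflectionE.
Qed.

Lemma reflection_setT c : reflection c @: [set: 'I_n] = [set: 'I_n].
Proof.
by apply/setP=> i; rewrite in_setT; apply/imsetP; exists (reflection c i);
  rewrite ?reflectionK.
Qed.

Lemma diagonals_reflection c S d : 2 <= #|S| ->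
  (d \in diagonals (reflection c @: S)) = (reflection c @: d \in diagonals S).
Proof.
by move=> S2; rewrite !in_setD sides_reflection // !inE subset_reflection
  card_reflection.
Qed.

Lemma reflect_diagonalsK c : involutive (@reflect_diagonals n c).
Proof. by move=> D; apply/setP=> d; rewrite !mem_reflect imset_reflectionK. Qed.

Lemma cell_reflection c D S : 2 < n ->
  cell D S -> cell (reflect_diagonals c D) (reflection c @: S).
Proof.
move=> n2 /and3P[S3 /subsetP sidesS disj]; have S2 := ltnW S3.
have T2 : 2 <= #|[set: 'I_n]| by rewrite cardsT card_ord ltnW.
apply/and3P; split; first by rewrite card_reflection.
  apply/subsetP=> d; rewrite sides_reflection // => /sidesS.
  by rewrite !in_setU mem_reflect -sides_reflection // reflection_setT.
apply/pred0P=> d; rewrite /= mem_reflect diagonals_reflection //.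
exact: (pred0P disj (reflection c @: d)).
Qed.

Lemma kangulation_reflection k c D : 2 < n ->
  kangulation k (reflect_diagonals c D) = kangulation k D.
Proof.
move=> n2.
have T2 : 2 <= #|[set: 'I_n]| by rewrite cardsT card_ord ltnW.
have imp E : kangulation k E -> kangulation k (reflect_diagonals c E).
  move=> /and3P[/subsetP diagE /forall_inP ncE /forallP cellE]; apply/and3P; split.
  - apply/subsetP=> d; rewrite mem_reflect => /diagE.
    by rewrite -diagonals_reflection // reflection_setT.
  - apply/forall_inP=> d; rewrite mem_reflect => /ncE/forall_inP nc.
    apply/forall_inP=> e; rewrite mem_reflect => /nc.
    by rewrite crossing_reflectionE.
  apply/forallP=> S; apply/implyP=> /(cell_reflection c n2).
  by rewrite reflect_diagonalsK => /(implyP (cellE _)); rewrite card_reflection.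
by apply/idP/idP=> [/imp|/imp//]; rewrite reflect_diagonalsK.
Qed.

(** [reflect_diagonals a] exchanges the k-angulations fixed by the two conjugate reflections. *)
Lemma num_fixed_conj k c c' (a : 'I_n) : 2 < n ->
  (forall i, reflection a (reflection c (reflection a i)) = reflection c' i) ->
  num_fixed_kangulations k c = num_fixed_kangulations k c'.
Proof.
move=> n2 conj; rewrite /num_fixed_kangulations.
rewrite -(card_imset _ (inv_inj (@reflect_diagonalsK a))).
apply: eq_card => D; rewrite [RHS]inE.
have conjD : reflect_diagonals c' D =
    reflect_diagonals a (reflect_diagonals c (reflect_diagonals a D)).
  apply/setP=> d; rewrite !mem_reflect -!imset_comp; congr (_ \in D).
  by apply: eq_imset => i /=; rewrite conj.
rewrite conjD; apply/imsetP/andP=> [[E]|[kD /eqP fD]].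
  rewrite inE => /andP[kE /eqP fE] ->.
  by rewrite kangulation_reflection // kE reflect_diagonalsK fE.
exists (reflect_diagonals a D); last by rewrite reflect_diagonalsK.
rewrite inE kangulation_reflection // kD /=; apply/eqP.
by rewrite -[RHS](congr1 (reflect_diagonals a) fD) reflect_diagonalsK.
Qed.

Lemma num_fixed_odd k c c' : 2 < n -> odd n -> c' = n.-1 :> nat ->
  num_fixed_kangulations k c = num_fixed_kangulations k c'.
Proof.
move=> n2 oddn c'n; have cn := ltn_ord c.
(* Conjugating i -> c - i by i -> a - i gives i -> 2a - c - i, which must be i -> -1 - i modulo n.
   So 2a + 1 = c modulo n, solvable because one of [c] and [c + n] is odd. *)
have [a an ea] : exists2 a, a < n & a.*2.+1 = c \/ a.*2.+1 = c + n.
  by have [oddc|evenc] := boolP (odd c); [exists c./2 | exists (c + n)./2]; lia.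
apply: (@num_fixed_conj _ _ _ (Ordinal an)) => // i; apply: ord_inj.
rewrite !reflectionE c'n /=; have ltin := ltn_ord i.
rewrite (_ : i <= n.-1); last lia.
by case: (leqP i a) => ?; case: (leqP _ c) => ?; case: leqP; lia.
Qed.

End Invariance.

Theorem theorem3p4 (n k : nat) (hn : 3 <= n) (hk : 3 <= k)
    (n_odd : odd n) (k_odd : odd k) (hnk : n = 2 %[mod k - 2]) (c : 'I_n) :
  let m := (n - 2) %/ (k - 2) in
  ((num_fixed_kangulations k c)%:R)%R =
    raney (k - 1) ((k - 1) %/ 2) ((m - 1) %/ 2).
Proof.
move=> m.
have n1 : n.-1 < n by lia.
rewrite (@num_fixed_odd _ k c (Ordinal n1)) //.
have nh : n = n./2.*2.+1 by lia.
have em : n - 2 = m * (k - 2).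
  by rewrite /m divnK // -eqn_mod_dvd ?hnk // ltnW.
have oddm : odd m.
  have : odd (n - 2) by lia.
  by rewrite em oddM => /andP[].
clearbody m.
have -> : num_fixed_kangulations k (Ordinal n1) = num_forests n k 0 n./2 k./2.
  rewrite -(@num_symmetric_forests n k n./2 (Ordinal n1)) //.
  by apply: eq_card => D; rewrite !inE kangulation_forest.
have ek : k = (k - 2).+2 by lia.
(* With m = 2j + 1, n - 2 = m (k - 2) gives n - 1 = (k - 1) + 2j (k - 2), which is then halved. *)
have eh : n./2 - 0 = k./2 + ((m - 1) %/ 2) * (k - 2).
  have em2 : m = ((m - 1) %/ 2).*2.+1 by lia.
  move: em; rewrite {1}em2; move: ((m - 1) %/ 2) => j; nia.
have -> : (k - 1) %/ 2 = k./2 by lia.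
have -> : k - 1 = (k - 2).+1 by lia.
by rewrite {1}ek; apply: num_forests_raney eh; lia.
Qed.
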